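(* Let $I$ be an ordinal and let $(X_i)_{i\in I}$ be a family of generalized ordered sets. Let $\mathscr{L}$ be any collection of initial segments of $I$. Suppose that for each finite subcollection $\{A_0,\dots,A_m\}$ of $\mathscr{L}$, the product $\prod_{i\in A_0\cup\dots\cup A_m}X_i$ with its lexicographic order is a generalized ordered set. Then the lexicographic order on $\prod_{i\in\bigcup\mathscr{L}}X_i$ is asymmetric and transitive. If, in addition, the relation $<$ on each $X_i$ is cotransitive, then the lexicographic order on $\prod_{i\in\bigcup\mathscr{L}}X_i$ is positively antisymmetric.
   Context: The setting is constructive mathematics: no use of the law of excluded middle. An ordinal is taken in the sense of the Homotopy Type Theory book: a set $I$ with a binary relation $<$ that is transitive, extensional and well-founded (every element accessible). For a set $X$ with a binary relation $<$, write $x\leq_{P}y$ if for all $z\in X$, $z<x$ implies $z<y$, and $y<z$ implies $x<z$. A generalized ordered set is a set $X$ with a binary relation $<$ that is asymmetric ($x<y$ implies $\neg(y<x)$), transitive ($x<y<z$ implies $x<z$) and positively antisymmetric ($x\leq_{P}y$ and $y\leq_{P}x$ imply $x=y$). A relation is cotransitive if $a<b$ implies $a<c$ or $c<b$. An initial segment of $I$ is a subset $S\subseteq I$ such that $s'\leq_{P}s\in S$ implies $s'\in S$. For $A\subseteq I$, $\prod_{i\in A}X_i$ is the set of functions $f$ on $A$ with $f(i)\in X_i$, with pointwise equality. Its lexicographic order is: $f<g$ iff there is $k\in A$ with $f(k)<g(k)$ and $f(j)=g(j)$ for all $j\in A$ with $j<k$. *)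

(* Defs.v *)
(* The setting is constructive, so no axiom is used.  A set is a type with
   Leibniz equality, except for products, whose equality is pointwise. *)
From Stdlib Require Export RelationClasses Wellfounded.

Set Implicit Arguments.

Definition leP (X : Type) (lt : X -> X -> Prop) (x y : X) : Prop :=
  forall z : X, (lt z x -> lt z y) /\ (lt y z -> lt x z).

(* [eqX] is the equality of the set: [eq], or [prod_eq] below for a product. *)
Definition positively_antisymmetric (X : Type) (eqX lt : X -> X -> Prop) : Prop :=
  forall x y : X, leP lt x y -> leP lt y x -> eqX x y.

Definition cotransitive (X : Type) (lt : X -> X -> Prop) : Prop :=
  forall a b c : X, lt a b -> lt a c \/ lt c b.

Record generalized_ordered_set (X : Type) (eqX lt : X -> X -> Prop) : Prop := {
  gos_asymmetric : Asymmetric lt;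
  gos_transitive : Transitive lt;
  gos_positively_antisymmetric : positively_antisymmetric eqX lt
}.

Definition extensional (I : Type) (lt : I -> I -> Prop) : Prop :=
  forall a b : I, (forall c : I, lt c a <-> lt c b) -> a = b.

Record ordinal (I : Type) (lt : I -> I -> Prop) : Prop := {
  ordinal_transitive : Transitive lt;
  ordinal_extensional : extensional lt;
  ordinal_well_founded : well_founded lt
}.

Definition initial_segment (I : Type) (lt : I -> I -> Prop) (S : I -> Prop) : Prop :=
  forall s' s : I, leP lt s' s -> S s -> S s'.

(* A function on the subset [A] depends on the element only, not on the proof
   of membership.  Proof irrelevance is not assumed, hence the second field. *)
Record product (I : Type) (X : I -> Type) (A : I -> Prop) : Type := {
  app :> forall i : I, A i -> X i;
  app_irrelevant : forall (i : I) (p q : A i), app p = app q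
}.

Arguments app {I X A} _ i _.

Definition prod_eq (I : Type) (X : I -> Type) (A : I -> Prop)
    (f g : product X A) : Prop :=
  forall (i : I) (p : A i), f i p = g i p.

Definition lex (I : Type) (ltI : I -> I -> Prop)
    (X : I -> Type) (ltX : forall i : I, X i -> X i -> Prop) (A : I -> Prop)
    (f g : product X A) : Prop :=
  exists (k : I) (p : A k),
    ltX k (f k p) (g k p) /\
    forall (j : I) (q : A j), ltI j k -> f j q = g j q.

Arguments lex {I} ltI {X} ltX A f g.

Definition union (I : Type) (L : (I -> Prop) -> Prop) : I -> Prop :=
  fun i => exists A : I -> Prop, L A /\ A i.

(* A 0 \cup ... \cup A m; the values A j for j > m are irrelevant. *)
Definition finite_union (I : Type) (m : nat) (A : nat -> I -> Prop) : I -> Prop :=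
  fun i => exists j : nat, j <= m /\ A j i.

(* Main.v *)
(** A lexicographic inequality over [union L] is witnessed at one index, hence
    inside one member of [L]; asymmetry and transitivity involve two
    inequalities, so they can be checked on the union of two members, which is
    closed under smaller indices.

    For positive antisymmetry, suppose [f] and [g] are [leP]-equivalent and
    agree below [k].  Then [f k < g k] would give [f < g], hence [f < f], and
    symmetrically.  By cotransitivity [z < f k] implies [z < g k] or
    [g k < f k], and the latter is excluded; the other three cases are similar,
    so [f k = g k] by positive antisymmetry of [X k]. *)
From Stdlib Require Import PeanoNat.
Require Import Defs.

Lemma lt_leP (X : Type) (lt : X -> X -> Prop) :
  Transitive lt -> forall x y : X, lt x y -> leP lt x y.
Proof.
  intros Htr x y Hxy z; split; intros Hz; eapply Htr; eassumption.
Qed.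

Lemma leP_of_not_lt (X : Type) (lt : X -> X -> Prop) :
  cotransitive lt -> forall x y : X, ~ lt y x -> leP lt x y.
Proof.
  intros Hco x y Hyx z; split; intros Hz.
  - destruct (Hco _ _ y Hz); tauto.
  - destruct (Hco _ _ x Hz); tauto.
Qed.

(** Initial segments are closed under [leP], which [lt] implies by transitivity. This is the closure
    needed to extend a lexicographic inequality from a union of members of [L]. *)
Lemma initial_segment_lt (I : Type) (lt : I -> I -> Prop) (S : I -> Prop) :
  Transitive lt -> initial_segment lt S ->
  forall j k : I, lt j k -> S k -> S j.
Proof.
  intros Htr HS j k Hjk; apply HS, lt_leP; assumption.
Qed.

Definition restrict {I : Type} {X : I -> Type} {A B : I -> Prop}
    (sub : forall i : I, B i -> A i) (f : product X A) : product X B :=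
  {| app := fun i p => f i (sub i p);
     app_irrelevant := fun i p q => app_irrelevant f i (sub i p) (sub i q) |}.

Section Lex.

Context {I : Type} {ltI : I -> I -> Prop}.
Context {X : I -> Type} {ltX : forall i : I, X i -> X i -> Prop}.

(** [A] is a member of [L] containing the witness. Letting [B] range over supersets of [A] allows
    two inequalities with different members to be restricted to one common subset. *)
Lemma lex_restrict {L : (I -> Prop) -> Prop} {f g : product X (union L)} :
  lex ltI ltX (union L) f g ->
  exists A : I -> Prop, L A /\
    forall (B : I -> Prop) (sub : forall i : I, B i -> union L i),
      (forall i : I, A i -> B i) ->
      lex ltI ltX B (restrict sub f) (restrict sub g).
Proof.
  intros (k & (A & HA & Ak) & Hlt & Heq).
  exists A; split; [assumption|]; intros B sub HAB.
  exists k, (HAB k Ak); split.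
  - cbn.
    (* The proof of [union L k] obtained through [B] is exchanged for the one built from [A]. *)
    rewrite (app_irrelevant f k _ (ex_intro _ A (conj HA Ak))),
      (app_irrelevant g k _ (ex_intro _ A (conj HA Ak))).
    exact Hlt.
  - intros j q Hjk; apply Heq, Hjk.
Qed.

(** The witness [k] lies in [B], so every index below [k] does too, and agreement on [B] below [k]
    is agreement on [A] below [k]. *)
Lemma lex_of_restrict {A : I -> Prop} (B : I -> Prop) (sub : forall i : I, B i -> A i)
    (f g : product X A) :
  (forall j k : I, ltI j k -> B k -> B j) ->
  lex ltI ltX B (restrict sub f) (restrict sub g) -> lex ltI ltX A f g.
Proof.
  intros HB (k & Bk & Hlt & Heq).
  exists k, (sub k Bk); split; [exact Hlt|]; intros j q Hjk.
  rewrite (app_irrelevant f j q (sub j (HB j k Hjk Bk))),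
    (app_irrelevant g j q (sub j (HB j k Hjk Bk))).
  apply Heq, Hjk.
Qed.

Lemma finite_union_pair (L : (I -> Prop) -> Prop) (A B : I -> Prop) :
  L A -> L B ->
  exists C : nat -> I -> Prop,
    (forall j : nat, j <= 1 -> L (C j)) /\
    (forall i : I, A i -> finite_union 1 C i) /\
    (forall i : I, B i -> finite_union 1 C i).
Proof.
  intros HA HB; exists (fun n => match n with 0 => A | S _ => B end).
  repeat split.
  - intros [|j] _; assumption.
  - intros i Ai; exists 0; split; [apply Nat.le_0_l | exact Ai].
  - intros i Bi; exists 1; split; [apply Nat.le_refl | exact Bi].
Qed.

Lemma finite_union_sub_union (L : (I -> Prop) -> Prop) {m : nat}
    (C : nat -> I -> Prop) :
  (forall j : nat, j <= m -> L (C j)) ->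
  forall i : I, finite_union m C i -> union L i.
Proof.
  intros HC i (j & Hj & Cji); exists (C j); auto.
Qed.

Lemma lex_union_asymmetric (L : (I -> Prop) -> Prop) :
  (forall (m : nat) (C : nat -> I -> Prop),
      (forall j : nat, j <= m -> L (C j)) ->
      Asymmetric (lex ltI ltX (finite_union m C))) ->
  Asymmetric (lex ltI ltX (union L)).
Proof.
  intros Hfin f g Hfg Hgf.
  destruct (lex_restrict Hfg) as (A & HA & HfgA).
  destruct (lex_restrict Hgf) as (B & HB & HgfB).
  destruct (finite_union_pair L A B HA HB) as (C & HC & HAC & HBC).
  set (sub := finite_union_sub_union L C HC).
  exact (Hfin 1 C HC _ _ (HfgA _ sub HAC) (HgfB _ sub HBC)).
Qed.

Lemma lex_union_transitive (L : (I -> Prop) -> Prop) :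
  (forall A : I -> Prop, L A -> forall j k : I, ltI j k -> A k -> A j) ->
  (forall (m : nat) (C : nat -> I -> Prop),
      (forall j : nat, j <= m -> L (C j)) ->
      Transitive (lex ltI ltX (finite_union m C))) ->
  Transitive (lex ltI ltX (union L)).
Proof.
  intros HL Hfin f g h Hfg Hgh.
  destruct (lex_restrict Hfg) as (A & HA & HfgA).
  destruct (lex_restrict Hgh) as (B & HB & HghB).
  destruct (finite_union_pair L A B HA HB) as (C & HC & HAC & HBC).
  set (sub := finite_union_sub_union L C HC).
  (* Transitivity holds over the union of the two members; the resulting inequality is carried back
     to [union L]. *)
  apply (lex_of_restrict (finite_union 1 C) sub).
  - intros j k Hjk (n & Hn & Cnk); exists n; split; [assumption|].
    exact (HL (C n) (HC n Hn) j k Hjk Cnk).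
  - exact (Hfin 1 C HC _ _ _ (HfgA _ sub HAC) (HghB _ sub HBC)).
Qed.

Lemma lex_irreflexive {A : I -> Prop} {f : product X A} :
  (forall i : I, Asymmetric (ltX i)) -> ~ lex ltI ltX A f f.
Proof.
  intros Has (k & p & Hlt & _); exact (Has k _ _ Hlt Hlt).
Qed.

Lemma lex_positively_antisymmetric (A : I -> Prop) :
  well_founded ltI ->
  (forall i : I, generalized_ordered_set eq (ltX i)) ->
  (forall i : I, cotransitive (ltX i)) ->
  positively_antisymmetric (@prod_eq I X A) (lex ltI ltX A).
Proof.
  intros Hwf HX Hco f g Hfg Hgf.
  assert (Has : forall i, Asymmetric (ltX i)) by (intros i; apply HX).
  (* Well-founded induction supplies the agreement of [f] and [g] below [k]. *)
  intros k; induction k as [k IH] using (well_founded_induction Hwf); intros p.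
  apply (gos_positively_antisymmetric (HX k));
    apply leP_of_not_lt; auto; intros Hlt.
  (* Here [Hfg] is used at [z = g]: it turns [g < f] into [g < g]. *)
  - apply (lex_irreflexive (f := g) Has), Hfg.
    exists k, p; split; [exact Hlt|]; intros j q Hj; symmetry; exact (IH j Hj q).
  - apply (lex_irreflexive (f := f) Has), Hgf.
    exists k, p; split; [exact Hlt|]; intros j q Hj; exact (IH j Hj q).
Qed.

End Lex.

Theorem theorem22
  (I : Type) (ltI : I -> I -> Prop) (HI : ordinal ltI)
  (X : I -> Type) (ltX : forall i : I, X i -> X i -> Prop)
  (HX : forall i : I, generalized_ordered_set eq (ltX i))
  (L : (I -> Prop) -> Prop)
  (HL : forall A : I -> Prop, L A -> initial_segment ltI A)
  (Hfin : forall (m : nat) (A : nat -> I -> Prop),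
      (forall j : nat, j <= m -> L (A j)) ->
      generalized_ordered_set (@prod_eq I X (finite_union m A))
                              (lex ltI ltX (finite_union m A))) :
  (Asymmetric (lex ltI ltX (union L)) /\ Transitive (lex ltI ltX (union L))) /\
  ((forall i : I, cotransitive (ltX i)) ->
   positively_antisymmetric (@prod_eq I X (union L)) (lex ltI ltX (union L))).
Proof.
  destruct HI as [Htr _ Hwf].
  split; [split|].
  - apply lex_union_asymmetric; intros m C HC; apply Hfin, HC.
  - apply lex_union_transitive.
    + intros A HA; apply initial_segment_lt; auto.
    + intros m C HC; apply Hfin, HC.
  - apply lex_positively_antisymmetric; assumption.
Qed.
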